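(* For $\beta\in\mathbb{N}$, $l,n\in\mathbb{N}$, $r\in\mathbb{Z}$ let $$T_{l,\beta}^{(2)}(n,r)=\frac{l!\,2^l}{\lfloor n/2^{\beta-1}\rfloor!}\sum_{k\equiv r\ (\mathrm{mod}\ 2^{\beta})}\binom nk(-1)^k\binom{(k-r)/2^{\beta}}l.$$ Let $\alpha,c,d,e\in\mathbb{N}$ with $d<2^e$. Then $$T_{l,\alpha+1}^{(2)}\big(2^{\alpha}(2^e+d),\,2^{\alpha}c\big)\equiv\delta_{l,d}\pmod 2\quad\text{for all } l=0,\ldots,d,$$ where $\delta_{l,d}$ is the Kronecker delta.
   Context: The sum runs over all integers $k\equiv r\pmod{2^\beta}$ with $\binom nk=0$ unless $0\le k\le n$; $\binom xl=x(x-1)\cdots(x-l+1)/l!$. For rationals $u,v$, $u\equiv v\pmod 2$ means $\operatorname{ord}_2(u-v)\ge1$. *)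

(* Defs.v *)
From mathcomp Require Import all_boot all_order all_algebra.
Set Implicit Arguments. Unset Strict Implicit. Unset Printing Implicit Defensive.
Import Order.TTheory GRing.Theory Num.Theory.
Local Open Scope ring_scope.

Definition binomz (x : int) (l : nat) : rat :=
  (\prod_(i < l) (x - (i : nat)%:Z)%:~R) / (l`!)%:R.

(* floor (n / 2^(beta-1)); for beta = 0 this is floor(2n) = 2n *)
Definition floor_n_pow (n beta : nat) : nat :=
  if beta is b.+1 then (n %/ 2 ^ b)%N else (n.*2)%N.

(* T^{(2)}_{l,beta}(n, r); the sum over k = r (mod 2^beta) is restricted to
   0 <= k <= n since binom n k = 0 otherwise. *)
Definition T2 (l beta n : nat) (r : int) : rat :=
  ((l`!)%:R * 2 ^+ l / ((floor_n_pow n beta)`!)%:R) *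
  \sum_(0 <= k < n.+1 | ((2 ^ beta)%N %| (k%:Z - r))%Z)
     ('C(n, k))%:R * (-1) ^+ k * binomz ((k%:Z - r) %/ (2 ^ beta)%N%:Z)%Z l.

(* u = v (mod 2) for rationals: ord_2(u - v) >= 1, i.e. the reduced
   numerator of u - v is even and its denominator is odd (0 included). *)
Definition rat_cong2 (u v : rat) : bool :=
  ~~ odd `|numq (u - v)|%N && odd `|denq (u - v)|%N.

(* Main.v *)
(* Write T_b(n, r) for T2 l b n r. For b = 1 the sum runs over one parity class and
   l! 2^l binom((k - r)/2, l) = prod_{i<l} (k - r - 2i) = sum_{j<=l} c_j k(k-1)...(k-j+1)
   with integral c_j and c_l = 1. The half sums of binomial coefficients turn
   this into T_1(n, r) = +- sum_j c_j 2^(n-j-1)/(n-j)!. Now 2^(k-1)/k! is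
   always 2-integral, and it is a 2-adic unit exactly when k is a power of 2; for
   n = 2^e + d and l <= d < 2^e only j = d can contribute modulo 2.

   To pass from b to b + 1, expand (1 - X)^(2n) = ((1 - X^2) - 2X(1 - X))^n. The
   j-th term is 'C(n, j) 2^j times an integral combination of the sums at level b for
   n - j; after normalization it carries the factor 2^j/j!, which is even for
   j > 0, so that T_(b+1)(2n, 2r) = T_b(n, r) mod 2. *)
Require Import Defs.
From HB Require Import structures.
From mathcomp Require Import all_boot all_order all_algebra.
From mathcomp Require Import zify ring.
Set Implicit Arguments. Unset Strict Implicit. Unset Printing Implicit Defensive.
Import Order.TTheory GRing.Theory Num.Theory.
Local Open Scope ring_scope.

(* The localization of the integers at 2; a congruence u = v (mod 2) is used in
   the form (u - v) / 2 \is a int2. *)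
Definition int2 := [qualify a x : rat | odd `|denq x|%N].

(** The fraction need not be reduced: the reduced denominator divides [b], hence is odd. This makes
    closure under the ring operations immediate. *)
Lemma int2P (y : rat) :
  reflect (exists (a : int) (b : nat), odd b /\ y = a%:~R / b%:R) (y \is a int2).
Proof.
apply: (iffP idP) => [xd | [a [b [ob ->]]]].
  exists (numq y), `|denq y|%N; split=> //.
  by rewrite -[RHS]/(_ / (Posz _)%:~R) -[LHS]divq_num_den absz_denq.
have b0 : (b%:R : rat) != 0 by rewrite pnatr_eq0; case: b ob.
set x := _ / _.
have E : numq x * b = a * denq x.
  apply: (@intr_inj rat); rewrite !rmorphM /= -[b%:~R]/(b%:R : rat).
  rewrite numqE mulrAC; congr (_ * _); exact: divfK.
have : (`|denq x| %| b)%N.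
  have : (`|denq x| %| `|numq x| * b)%N.
    by rewrite -[b]/(`|Posz b|%N) -abszM E abszM dvdn_mull.
  by rewrite Gauss_dvdr // coprime_sym coprime_num_den.
by rewrite qualifE => /dvdnP[k kE]; move: ob; rewrite kE oddM => /andP[].
Qed.

Fact int2_subring : subring_closed int2.
Proof.
split.
- by apply/int2P; exists 1, 1%N; split.
- move=> _ _ /int2P[a [b [ob ->]]] /int2P[a' [b' [ob' ->]]].
  apply/int2P; exists (a * b' - a' * b), (b * b')%N; split; first by rewrite oddM ob.
  have b0 : (b%:R : rat) != 0 by rewrite pnatr_eq0; case: (b) ob.
  have b0' : (b'%:R : rat) != 0 by rewrite pnatr_eq0; case: (b') ob'.
  rewrite rmorphB !rmorphM /= -[b%:~R]/(b%:R : rat) -[b'%:~R]/(b'%:R : rat).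
  by field; rewrite b0 b0'.
- move=> _ _ /int2P[a [b [ob ->]]] /int2P[a' [b' [ob' ->]]].
  apply/int2P; exists (a * a'), (b * b')%N; split; first by rewrite oddM ob.
  by rewrite !rmorphM invfM mulrACA.
Qed.

HB.instance Definition _ := GRing.isSubringClosed.Build rat _ int2_subring.

Lemma int2_odd_inv (b : nat) : odd b -> b%:R^-1 \is a int2.
Proof. by move=> ob; apply/int2P; exists 1, b; rewrite mul1r. Qed.

Lemma even2_int2 (x : rat) : x / 2%:R \is a int2 -> x \is a int2.
Proof. by move=> h; rewrite -[x](@divfK _ 2%:R) // rpredM // rpred_nat. Qed.

Lemma rat_cong2P (u v : rat) : (u - v) / 2%:R \is a int2 -> rat_cong2 u v.
Proof.
move=> /int2P[a [b [ob E]]].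
have b0 : (b%:R : rat) != 0 by rewrite pnatr_eq0; case: b ob E.
rewrite /rat_cong2; set x := u - v in E *.
have {}E : x = (a * 2)%:~R / b%:R.
  by rewrite rmorphM /= mulrAC -E divfK.
have ox : odd `|denq x|%N by apply/int2P; exists (a * 2), b.
rewrite ox andbT.
have : `|numq x * b| = `|a * 2 * denq x|.
  congr `|_|; apply: (@intr_inj rat).
  rewrite rmorphM [RHS]rmorphM /= -[b%:~R]/(b%:R : rat).
  rewrite numqE mulrAC; congr (_ * _); rewrite E; exact: divfK.
move=> /(congr1 (fun z : int => odd `|z|%N)); rewrite !normrM !abszM !oddM !absz_id ob andbF.
by rewrite andbT => ->.
Qed.

(** * The 2-adic behaviour of 2^(k-1)/k! *)

(** By truncation the value at 0 is 1 instead of 1/2, so only k > 0 is meaningful. *)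
Definition pow2_fact_ratio (k : nat) : rat := 2%:R ^+ k.-1 / k`!%:R.

Lemma fact_double k : exists2 o, odd o & (k.*2)`! = (2 ^ k * k`! * o)%N.
Proof.
elim: k => [|k [o oo E]]; first by exists 1%N.
exists (k.*2.+1 * o)%N; first by rewrite oddM /= odd_double.
by rewrite doubleS !factS E expnS; lia.
Qed.

Lemma fact_neq0 k : (k`!%:R : rat) != 0.
Proof. by rewrite pnatr_eq0 -lt0n fact_gt0. Qed.

(** Induction on [e] by halving the index: (2k)! = 2^k k! o with o odd, so passing from k to 2k only
    divides the ratio by o, while passing from 2k to 2k+1 multiplies it by 2/(2k+1) and makes it
    even. *)
Lemma pow2_fact_ratio_mod2 e u : (u < 2 ^ e)%N ->
  (pow2_fact_ratio (2 ^ e + u) - (u == 0%N)%:R) / 2%:R \is a int2.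
Proof.
elim: e u => [|e IH] u.
  by rewrite expn0; case: u => // _; rewrite /pow2_fact_ratio /= subrr mul0r rpred0.
rewrite expnS => ult.
have {IH} := IH u./2; set k := (2 ^ e + u./2)%N => IH.
have {}IH := IH ltac:(lia).
have k0 : (0 < k)%N by rewrite /k; have := expn_gt0 2 e; lia.
have -> : (2 * 2 ^ e + u)%N = (odd u + k.*2)%N by rewrite /k; lia.
have [o oo E] := fact_double k.
have h2 : pow2_fact_ratio k.*2 = pow2_fact_ratio k * o%:R^-1.
  rewrite /pow2_fact_ratio E !natrM natrX.
  have -> : k.*2.-1 = (k + k.-1)%N by lia.
  have o0 : (o%:R : rat) != 0 by rewrite pnatr_eq0; case: (o) oo.
  by rewrite exprD; field; rewrite o0 fact_neq0 expf_neq0.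
have hk : pow2_fact_ratio k \is a int2.
  rewrite -[pow2_fact_ratio k](subrK (u./2 == 0%N)%:R) rpredD ?rpred_nat //.
  exact: even2_int2.
case: (boolP (odd u)) => ou.
  have -> : (u == 0)%N = false by case: (u) ou.
  rewrite subr0 add1n.
  have -> : pow2_fact_ratio k.*2.+1 / 2%:R = pow2_fact_ratio k.*2 * k.*2.+1%:R^-1.
    have E2 : (2%:R ^+ k.*2 : rat) = 2%:R * 2%:R ^+ k.*2.-1.
      by rewrite -exprS prednK ?double_gt0.
    have n0 : (k.*2.+1%:R : rat) != 0 by rewrite pnatr_eq0.
    rewrite /pow2_fact_ratio factS natrM /= E2; field.
    by rewrite nat1r n0 fact_neq0.
  rewrite h2 rpredM //; first by rewrite rpredM ?int2_odd_inv.
  by rewrite int2_odd_inv //= odd_double.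
have -> : (u == 0)%N = (u./2 == 0)%N by move: ou; lia.
rewrite add0n h2.
set t := pow2_fact_ratio k in hk IH *; set dl := (_ == _)%:R in IH *.
(* Division by an odd o = 1 + 2 [o./2] preserves the class mod 2. *)
have -> : (t / o%:R - dl) / 2%:R =
   (t - dl) / 2%:R * o%:R^-1 - dl * (o./2)%:R * o%:R^-1.
  have oE : (o%:R : rat) = 1 + 2%:R * (o./2)%:R.
    by rewrite -natrM -[1]/(1%:R) -natrD; congr _%:R; move: oo; lia.
  have : (o%:R : rat) != 0 by rewrite pnatr_eq0; case: (o) oo.
  by rewrite oE => h; field.
have oi := int2_odd_inv oo.
apply: rpredB; first exact: rpredM IH oi.
apply: rpredM oi; apply: rpredM; exact: rpred_nat.
Qed.

Lemma pow2_fact_ratio_int2 k : (0 < k)%N -> pow2_fact_ratio k \is a int2.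
Proof.
move=> k0; set e := trunc_log 2 k.
have /andP[h1 h2] := trunc_log_bounds (isT : (1 < 2)%N) k0.
have := @pow2_fact_ratio_mod2 e (k - 2 ^ e).
rewrite subnKC //; move: h2; rewrite expnS => h2 /(_ ltac:(rewrite -/e in h1 h2; lia)) H.
rewrite -[pow2_fact_ratio k](subrK (k - 2 ^ e == 0)%N%:R) rpredD ?rpred_nat //.
exact: even2_int2.
Qed.

(** * Evenness of the expansion coefficients *)

(** From n to n+1 the quotient n!/floor(n/2^a)! gains the factor n+1, or just 2^a when 2^a divides
    n+1, since the floor then grows as well. *)
Lemma fact_ratio_dvd a n : exists z, ((n.+1)`! * (n %/ 2 ^ a)`! =
   z * (n`! * (n.+1 %/ 2 ^ a)`!))%N.
Proof.
rewrite divnS ?expn_gt0 //; case: (boolP (2 ^ a %| n.+1)%N) => [dv|_].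
  exists (2 ^ a)%N; rewrite add1n !factS.
  have -> : n.+1 = (2 ^ a * (n %/ 2 ^ a).+1)%N.
    rewrite -[(n %/ _).+1]add1n -[X in (X + _)%N]/(nat_of_bool true) -dv.
    by rewrite -divnS ?expn_gt0 // mulnC divnK.
  lia.
by exists n.+1; rewrite add0n factS; lia.
Qed.

Lemma fact_ratio_dvd_sub a j n : (j <= n)%N -> exists z, (n`! * ((n - j) %/ 2 ^ a)`! =
   z * ((n - j)`! * (n %/ 2 ^ a)`!))%N.
Proof.
elim: j => [|j IH] jn; first by exists 1%N; rewrite subn0; lia.
have [z Hz] := IH (ltnW jn).
have [y Hy] := fact_ratio_dvd a (n - j.+1).
rewrite -subSn // subSS in Hy.
exists (z * y)%N; apply/eqP.
rewrite -(eqn_pmul2r (fact_gt0 (n - j))) -(eqn_pmul2r (fact_gt0 ((n - j) %/ 2 ^ a))).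
by apply/eqP; have := f_equal2 muln Hz Hy; lia.
Qed.

(* The numerical factor of term j in the expansion of
   (1 - X)^(2n) = ((1 - X^2) - 2 X (1 - X))^n, including the quotient of the
   factorials that normalize T2 at n - j and at n. *)
Definition sq_expansion_coef a n j : rat :=
  'C(n, j)%:R * 2%:R ^+ j * (((n - j) %/ 2 ^ a)`!)%:R / ((n %/ 2 ^ a)`!)%:R.

(** Since 'C(n, j) = n!/(j! (n-j)!), the divisibility of factorial quotients turns the coefficient
    into z 2^j/j! with z an integer. *)
Lemma sq_expansion_coef_even a n j : (0 < j <= n)%N -> sq_expansion_coef a n j / 2%:R \is a int2.
Proof.
case/andP=> j0 jn; have [z Hz] := fact_ratio_dvd_sub a jn.
suff -> : sq_expansion_coef a n j / 2%:R = z%:R * pow2_fact_ratio j.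
  by rewrite rpredM ?rpred_nat ?pow2_fact_ratio_int2.
have E2 : (2%:R ^+ j : rat) = 2%:R * 2%:R ^+ j.-1 by rewrite -exprS prednK.
have EC : 'C(n, j)%:R * (j`!%:R * (n - j)`!%:R) = n`!%:R :> rat.
  by rewrite -!natrM bin_fact.
have {}Hz : n`!%:R * ((n - j) %/ 2 ^ a)`!%:R =
  z%:R * ((n - j)`!%:R * (n %/ 2 ^ a)`!%:R) :> rat by rewrite -!natrM Hz.
have h1 := fact_neq0 j; have h2 := fact_neq0 (n - j); have h3 := fact_neq0 (n %/ 2 ^ a).
rewrite /sq_expansion_coef /pow2_fact_ratio E2.
set c := 'C(n, j)%:R in EC *; move: Hz; rewrite -EC.
move: (j`!%:R) ((n - j)`!%:R) ((n %/ 2 ^ a)`!%:R) (((n - j) %/ 2 ^ a)`!%:R) h1 h2 h3.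
move=> fj fnj fm fm' h1 h2 h3 H.
have {}H : c * fj * fm' = z%:R * fm.
  by apply: (mulfI h2); transitivity (c * (fj * fnj) * fm'); [ring | rewrite H; ring].
transitivity (c * fj * fm' * 2%:R ^+ j.-1 / fj / fm); first by field; rewrite h1 h3.
by rewrite H; field; rewrite h1 h3.
Qed.

(** * [T2] as a linear functional of (1 - X)^n *)

(** The linear functional sending X^k to [w k]; it lets polynomial identities act on the sums. *)
Definition umbral (w : nat -> rat) (p : {poly rat}) : rat :=
  \sum_(k < size p) p`_k * w k.

Lemma umbral_widen w (p : {poly rat}) n : (size p <= n)%N ->
  umbral w p = \sum_(k < n) p`_k * w k.
Proof.
move=> pn; rewrite /umbral (big_ord_widen _ (fun k => p`_k * w k) pn).
rewrite [RHS](bigID (fun i : 'I_n => (i < size p)%N)) /= [X in _ + X]big1 ?addr0 //.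
by move=> i; rewrite -leqNgt => /(nth_default 0) ->; rewrite mul0r.
Qed.

Lemma umbral_is_linear w : linear_for *%R (umbral w).
Proof.
move=> a p q; pose n := maxn (size p) (size q).
have hp : (size p <= n)%N by rewrite leq_maxl.
have hq : (size q <= n)%N by rewrite leq_maxr.
have hpq : (size (a *: p + q)%R <= n)%N.
  apply: (leq_trans (size_polyD _ _)); rewrite geq_max hq andbT.
  exact: leq_trans (size_scale_leq _ _) hp.
rewrite !(umbral_widen _ hp) (umbral_widen _ hq) (umbral_widen _ hpq) mulr_sumr -big_split.
by apply: eq_bigr => i _ /=; rewrite coefD coefZ mulrDl mulrA.
Qed.

HB.instance Definition _ w :=
  GRing.isLinear.Build rat {poly rat} rat _ (umbral w) (umbral_is_linear w).

Lemma umbralXn w k : umbral w 'X^k = w k.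
Proof.
rewrite /umbral size_polyXn big_ord_recr /= coefXn eqxx mul1r big1 ?add0r // => i _.
by rewrite coefXn ltn_eqF ?ltn_ord // mul0r.
Qed.

Lemma umbral_shift_double w i (p : {poly rat}) :
  umbral w ('X^i * (p \Po 'X^2)) = umbral (fun k => w (i + k.*2)%N) p.
Proof.
rewrite comp_polyE mulr_sumr linear_sum; apply: eq_bigr => k _ /=.
by rewrite -scalerAr linearZ /= -exprM -exprD mul2n umbralXn.
Qed.

Lemma eq_umbral w w' p : w =1 w' -> umbral w p = umbral w' p.
Proof. by move=> E; apply: eq_bigr => i _; rewrite E. Qed.

Definition weight l b (r : int) (k : nat) : rat :=
  if ((2 ^ b)%N %| (k%:Z - r))%Z then binomz ((k%:Z - r) %/ (2 ^ b)%N%:Z)%Z l else 0.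

(** With r = 2s + i, the difference i + 2k - r is 2(k - s), so dividing by 2^(b+1) amounts to
    dividing k - s by 2^b. *)
Lemma weight_double l b (r : int) i : (2 %| r - i%:Z)%Z ->
  (fun k => weight l b.+1 r (i + k.*2)) =1 weight l b ((r - i%:Z) %/ 2)%Z.
Proof.
move=> /dvdzP[s E] k; rewrite /weight E mulzK //.
have -> : (i + k.*2)%N%:Z - r = 2 * (k%:Z - s).
  by rewrite (_ : r = s * 2 + i%:Z) -?E; lia.
have -> : (2 ^ b.+1)%N%:Z = 2 * (2 ^ b)%N%:Z by rewrite expnS.
by rewrite dvdz_mul2l //= divzMpl.
Qed.

Lemma weight_double0 l b (r : int) i : ~~ (2 %| r - i%:Z)%Z ->
  (fun k => weight l b.+1 r (i + k.*2)) =1 (fun=> 0).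
Proof.
move=> nd k; rewrite /weight; case: ifP => // /dvdzP[s E]; case/negP: nd.
apply/dvdzP; exists (k%:Z - s * (2 ^ b)%N%:Z).
have := E; have -> : (2 ^ b.+1)%N%:Z = 2 * (2 ^ b)%N%:Z by rewrite expnS.
move: ((2 ^ b)%N%:Z) => t; nia.
Qed.

Lemma umbral0 p : umbral (fun=> 0) p = 0.
Proof. by rewrite /umbral big1 // => i _; rewrite mulr0. Qed.

Lemma T2E l b n r : T2 l b.+1 n r =
  (l`!%:R * 2%:R ^+ l / ((n %/ 2 ^ b)`!)%:R) * umbral (weight l b.+1 r) ((1 - 'X) ^+ n).
Proof.
rewrite /T2 /=; congr (_ * _); rewrite exprDn linear_sum /= big_mkcond big_mkord /=.
apply: eq_bigr => k _; rewrite expr1n mul1r [(- 'X) ^+ k]exprNn linearMn /=.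
have -> : (-1) ^+ k * 'X^k = (-1) ^+ k *: 'X^k :> {poly rat}.
  by rewrite -mul_polyC rmorphXn rmorphN1.
rewrite linearZ /= umbralXn /weight.
case: ifP => _; rewrite ?mulr0 ?mul0rn //=.
by move: (binomz _ l) => B; rewrite -[RHS]mulr_natl [RHS]mulrA.
Qed.

(** * From one level to the next *)

(** Each monomial X^i of [A] contributes a sum one level down with residue (r - i)/2, or 0 if r - i
    is odd; as i varies so does the residue, whence the hypothesis for every [s]. *)
Lemma umbral_double_int2 l b (r : int) (K : rat) (A Q : {poly rat}) :
  A \is a polyOver int2 ->
  (forall s : int, K * umbral (weight l b s) Q \is a int2) ->
  K * umbral (weight l b.+1 r) (A * (Q \Po 'X^2)) \is a int2.
Proof.
move=> /polyOverP Ai HQ; rewrite -[A]coefK poly_def mulr_suml linear_sum mulr_sumr.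
apply: rpred_sum => i _; rewrite -scalerAl linearZ /= mulrCA rpredM //.
rewrite umbral_shift_double; case: (boolP (2 %| r - i%:Z)%Z) => h.
  by rewrite (eq_umbral _ (weight_double l b h)).
by rewrite (eq_umbral _ (weight_double0 l b h)) umbral0 mulr0 rpred0.
Qed.

(** The cofactor of (1 - X^2)^(n-j) in term j; [eps] accommodates odd exponents. *)
Definition sq_expansion_poly eps j : {poly rat} := (1 - 'X) ^+ eps * (- 'X * (1 - 'X)) ^+ j.

Lemma sq_expansion_poly_int2 eps j : sq_expansion_poly eps j \is a polyOver int2.
Proof. by rewrite /sq_expansion_poly !(rpredM, rpredX, rpredN, rpredB, rpred1, polyOverX). Qed.

Lemma sq_expansion eps n : (1 - 'X) ^+ (eps + n.*2) =
  \sum_(j < n.+1) ('C(n, j)%:R * 2%:R ^+ j) *: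
     (sq_expansion_poly eps j * ((1 - 'X) ^+ (n - j) \Po 'X^2)) :> {poly rat}.
Proof.
rewrite exprD -mul2n exprM.
have -> : (1 - 'X) ^+ 2 = (1 - 'X^2) + 2%:R *: (- 'X * (1 - 'X)) :> {poly rat}.
  by rewrite scaler_nat; ring.
rewrite [(_ + _ *: _) ^+ n]exprDn mulr_sumr; apply: eq_bigr => j _.
rewrite exprZn rmorphXn /= rmorphB /= comp_polyX rmorph1 -mulrnAr -scaler_nat.
rewrite -!scalerAr scalerA /sq_expansion_poly; congr (_ *: _).
by rewrite -!mulrA; congr (_ * _); exact: mulrC.
Qed.

Lemma T2_expansion_term_int2 l b n r eps j : (j <= n)%N ->
  (forall s : int, T2 l b.+1 (n - j) s \is a int2) ->
  (l`!%:R * 2%:R ^+ l / (((n - j) %/ 2 ^ b)`!)%:R) *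
     umbral (weight l b.+2 r) (sq_expansion_poly eps j * ((1 - 'X) ^+ (n - j) \Po 'X^2)) \is a int2.
Proof.
move=> jn H; apply: umbral_double_int2; first exact: sq_expansion_poly_int2.
by move=> s; rewrite -T2E.
Qed.

Lemma T2_expansion l b n r eps : (eps <= 1)%N ->
  T2 l b.+2 (eps + n.*2) r = \sum_(j < n.+1) sq_expansion_coef b n j *
  ((l`!%:R * 2%:R ^+ l / (((n - j) %/ 2 ^ b)`!)%:R) *
     umbral (weight l b.+2 r) (sq_expansion_poly eps j * ((1 - 'X) ^+ (n - j) \Po 'X^2))).
Proof.
move=> e1; rewrite T2E sq_expansion linear_sum mulr_sumr /=.
have -> : ((eps + n.*2) %/ 2 ^ b.+1 = n %/ 2 ^ b)%N.
  by rewrite expnS divnMA; congr (_ %/ _)%N; lia.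
apply: eq_bigr => j _; rewrite linearZ /= /sq_expansion_coef.
have h := fact_neq0 ((n - j) %/ 2 ^ b); have h' := fact_neq0 (n %/ 2 ^ b).
by field; rewrite h h'.
Qed.

Lemma sq_expansion_coef0 b n : sq_expansion_coef b n 0 = 1.
Proof. by rewrite /sq_expansion_coef bin0 subn0 expr0 !mul1r divff // fact_neq0. Qed.

Lemma T2_double_mod2 l b n r :
  (forall m (s : int), T2 l b.+1 m s \is a int2) ->
  (T2 l b.+2 n.*2 (2 * r) - T2 l b.+1 n r) / 2%:R \is a int2.
Proof.
move=> H.
have shift0 (Q : {poly rat}) :
    umbral (weight l b.+2 (2 * r)) (Q \Po 'X^2) = umbral (weight l b.+1 r) Q.
  rewrite -[_ \Po _]mul1r -(expr0 'X) umbral_shift_double.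
  have d2 : (2 %| 2 * r - 0%N%:Z)%Z by rewrite subr0 dvdz_mulr.
  by rewrite (eq_umbral _ (weight_double l b.+1 d2)) subr0 mulKz.
rewrite -[n.*2]add0n T2_expansion // big_ord_recl /= sq_expansion_coef0 mul1r.
have -> : sq_expansion_poly 0 0 = 1 by rewrite /sq_expansion_poly !expr0 mul1r.
(* The term j = 0 is exactly [T2] one level down and cancels; every other term is an even
   coefficient times a 2-integral number. *)
rewrite mul1r subn0 shift0 -T2E addrC addKr mulr_suml rpred_sum // => j _.
have jn : (0 < bump 0 j <= n)%N by rewrite /bump /= add1n ltn_ord.
rewrite mulrAC rpredM ?sq_expansion_coef_even //.
by apply: T2_expansion_term_int2; first by case/andP: jn.
Qed.

Lemma T2_succ_int2 l b :
  (forall m (s : int), T2 l b.+1 m s \is a int2) ->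
  forall n (r : int), T2 l b.+2 n r \is a int2.
Proof.
move=> H n r; rewrite -(odd_double_half n) T2_expansion ?leq_b1 //.
apply: rpred_sum => j _; apply: rpredM; last first.
  by apply: T2_expansion_term_int2; first by rewrite -ltnS.
case: (posnP j) => [-> | j0]; first by rewrite sq_expansion_coef0 rpred1.
by rewrite even2_int2 // sq_expansion_coef_even // j0 -ltnS /=.
Qed.

(** * The base level, modulus 2 *)

Lemma falling_expansion l (r : int) : exists c : nat -> int, [/\ c l = 1,
  forall j, (l < j)%N -> c j = 0 &
  forall k : nat, \prod_(i < l) (k%:Z - r - 2 * (i : nat)%:Z) =
    \sum_(j < l.+1) c j * (k ^_ j)%N%:Z].
Proof.
elim: l => [|l [c [cl c0 Hc]]].
  exists (fun j => (j == 0%N)%:Z); split=> // [[]// | k].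
  by rewrite big_ord0 big_ord1 /= ffactn0.
(* The recurrence comes from (k - r - 2l) k^_j = k^_(j+1) + (j - r - 2l) k^_j. *)
exists (fun j => (if j is i.+1 then c i else 0) + (j%:Z - r - 2 * l%:Z) * c j).
split=> [|j lj|k]; first by rewrite cl c0 // mulr0 addr0.
  by case: j lj => // j lj; rewrite !c0 ?addr0 ?mulr0 //; lia.
rewrite big_ord_recr /= Hc.
under [RHS]eq_bigr do rewrite mulrDl.
rewrite big_split /= [X in _ = X + _]big_ord_recl /= mul0r add0r.
rewrite [X in _ = _ + X]big_ord_recr /= c0 // mulr0 mul0r addr0 -big_split mulr_suml.
apply: eq_bigr => j _; rewrite ffactnSr /=.
case: (leqP j k) => jk; last by rewrite ffact_small // mul0n !mulr0 mul0r.
by rewrite PoszM -subzn //; ring.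
Qed.

(** Half the sum or difference of (1+1)^n and (1-1)^n; the latter is 1 for n = 0. *)
Lemma sum_bin_parity n (b : bool) :
  \sum_(0 <= k < n.+1 | odd k == b) ('C(n, k))%:R =
  (2%:R ^+ n + (-1) ^+ b * 0 ^+ n) / 2%:R :> rat.
Proof.
have E1 : 2%:R ^+ n = \sum_(k < n.+1) ('C(n, k))%:R :> rat.
  by rewrite (_ : 2%:R = 1 + 1) // exprDn; apply: eq_bigr => k _; rewrite !expr1n mulr1.
have E2 : 0 ^+ n = \sum_(k < n.+1) (-1) ^+ k * ('C(n, k))%:R :> rat.
  rewrite -[0](subrr 1) exprDn; apply: eq_bigr => k _.
  by rewrite expr1n mul1r mulr_natr.
rewrite E1 E2 mulr_sumr -big_split mulr_suml big_mkcond big_mkord /=.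
apply: eq_bigr => k _; rewrite -[(-1) ^+ k]signr_odd; move: ('C(n, k)%:R) => C.
by case: (odd k); case: b => /=; rewrite ?expr0 ?expr1; field.
Qed.

(** Absorption 'C(n, k) k^_j = n^_j 'C(n-j, k-j); the shift by j changes the parity class by that of
    j. *)
Lemma sum_bin_ffact n j (b : bool) : (j <= n)%N ->
  \sum_(0 <= k < n.+1 | odd k == b) ('C(n, k) * k ^_ j)%N%:R =
  (n ^_ j)%:R * \sum_(0 <= k < (n - j).+1 | odd k == b (+) odd j) ('C(n - j, k))%:R :> rat.
Proof.
move=> jn; rewrite (big_cat_nat (n := j)) //=; last by rewrite leqW.
rewrite big_nat_cond big1 ?add0r; last first.
  by move=> k /andP[/andP[_ kj] _]; rewrite ffact_small // muln0.
rewrite -{1}[j]add0n big_addn mulr_sumr subSn //.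
apply: congr_big => // k; first by rewrite oddD; case: (odd k); case: (odd j); case: b.
move=> _; rewrite -natrM; congr _%:R; case: (leqP k (n - j)) => kn; last first.
  by rewrite !bin_small ?muln0 //; lia.
apply/eqP; rewrite -(eqn_pmul2r (fact_gt0 k)) -(eqn_pmul2r (fact_gt0 (n - j - k))).
apply/eqP.
have kjn : (k + j <= n)%N by lia.
have e1 := bin_fact kjn.
have e2 := bin_fact kn.
have e3 := ffact_fact (leq_addl k j).
have e4 := ffact_fact jn.
rewrite addnK in e3.
have e5 : (n - (k + j) = n - j - k)%N by lia.
rewrite e5 in e1.
transitivity n`!; first by rewrite -e1 -e3; lia.
by rewrite -e4 -e2; lia.
Qed.

Definition parity_term n j (b : bool) : rat :=
  (\sum_(0 <= k < n.+1 | odd k == b) ('C(n, k) * k ^_ j)%N%:R) / n`!%:R.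

Lemma parity_termE n j b : (j < n)%N -> parity_term n j b = pow2_fact_ratio (n - j).
Proof.
move=> jn; have h0 : (n - j == 0)%N = false by lia.
rewrite /parity_term sum_bin_ffact 1?ltnW // sum_bin_parity expr0n h0 mulr0 addr0.
have := fact_neq0 n; rewrite -(ffact_fact (ltnW jn)) natrM mulf_eq0 negb_or => /andP[h1 h2].
rewrite /pow2_fact_ratio -{1}(@prednK (n - j)) ?subn_gt0 // exprS.
by field; rewrite h1 h2.
Qed.

Lemma parity_term_int2 n j b : parity_term n j b \is a int2.
Proof.
case: (ltngtP j n) => jn; first by rewrite parity_termE // pow2_fact_ratio_int2 // subn_gt0.
  rewrite /parity_term big_nat_cond big1 ?mul0r ?rpred0 // => k /andP[/andP[_ kj] _].
  by rewrite ffact_small ?muln0 //; lia.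
rewrite jn /parity_term sum_bin_ffact // ffactnn subnn mulrAC divff ?fact_neq0 // mul1r.
by rewrite rpred_sum // => k _; rewrite rpred_nat.
Qed.

Lemma dvd2_parity (k : nat) (r : int) : ((2 ^ 1)%N %| (k%:Z - r))%Z = (odd k == odd `|r|%N).
Proof. by rewrite expn1; lia. Qed.

Lemma binomz_half (x : int) l : (2 %| x)%Z ->
  l`!%:R * 2%:R ^+ l * binomz (x %/ 2)%Z l =
  (\prod_(i < l) (x - 2 * (i : nat)%:Z))%:~R.
Proof.
move=> /dvdzP[y ->]; rewrite mulzK // /binomz rmorph_prod /=.
rewrite mulrC mulrA divfK ?fact_neq0 // -[X in _ ^+ X]card_ord -prodr_const -big_split /=.
by apply: eq_bigr => i _; rewrite -[2%:R]/(2%:~R : rat) -rmorphM /= mulrBl [i%:Z * _]mulrC.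
Qed.

Lemma T2_beta1 l n (r : int) : exists c : nat -> int, c l = 1 /\
  T2 l 1 n r = (-1) ^+ odd `|r|%N *
     \sum_(j < l.+1) (c j)%:~R * parity_term n j (odd `|r|%N).
Proof.
have [c [cl _ Hc]] := falling_expansion l r; exists c; split=> //.
rewrite /T2 /= expn0 divn1 -[_ * 2%:R ^+ l / _]mulrC.
under eq_bigl do rewrite dvd2_parity.
rewrite -mulrA mulr_sumr.
under [X in _ * X = _]eq_bigr => k /eqP kb.
  rewrite mulrCA binomz_half ?Hc; last by rewrite -[2]/(2 ^ 1)%N%:Z dvd2_parity kb.
  rewrite -signr_odd kb rmorph_sum /= mulrAC mulr_sumr.
  over.
rewrite -mulr_suml exchange_big /= mulrA [RHS]mulrC; congr (_ * _).
rewrite mulr_sumr; apply: eq_bigr => j _.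
rewrite /parity_term mulrA [LHS]mulrC; congr (_ / _).
rewrite mulr_sumr; apply: eq_bigr => k _.
by rewrite rmorphM /= natrM mulrCA.
Qed.

Lemma T2_beta1_int2 l n (r : int) : T2 l 1 n r \is a int2.
Proof.
have [c [_ ->]] := T2_beta1 l n r.
apply: rpredM; first by rewrite rpredX // rpredN rpred1.
by apply: rpred_sum => j _; rewrite rpredM ?rpred_int ?parity_term_int2.
Qed.

(** Term j carries the ratio at 2^e + (d - j), odd only for j = d. As j <= l <= d, this forces j = l
    = d, where the coefficient is 1. *)
Lemma T2_beta1_mod2 l d e (r : int) : (d < 2 ^ e)%N -> (l <= d)%N ->
  (T2 l 1 (2 ^ e + d) r - (l == d)%:R) / 2%:R \is a int2.
Proof.
move=> de ld; have [c [cl ->]] := T2_beta1 l (2 ^ e + d) r.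
set b := odd _; set S := \sum_(j < _) _.
have HS : (S - (l == d)%:R) / 2%:R \is a int2.
  have -> : (l == d)%:R = \sum_(j < l.+1) (c j)%:~R * (d - j == 0)%N%:R :> rat.
    rewrite big_ord_recr /= big1 ?add0r; last first.
      by move=> j _; rewrite (_ : (_ == _) = false) ?mulr0 //; have := ltn_ord j; lia.
    by rewrite cl mul1r; congr (nat_of_bool _)%:R; lia.
  rewrite -sumrB mulr_suml rpred_sum // => j _.
  have jl : (j <= l)%N by rewrite -ltnS.
  rewrite -mulrBr -mulrA rpredM ?rpred_int // parity_termE; last by lia.
  by rewrite -addnBA; [apply: pow2_fact_ratio_mod2; lia | lia].
clearbody S b; case: b; rewrite ?expr0 ?mul1r // expr1 mulN1r.
(* The global sign is immaterial mod 2. *)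
have -> : (- S - (l == d)%:R) / 2%:R = - ((S - (l == d)%:R) / 2%:R) - (l == d)%:R by field.
by rewrite rpredB ?rpredN ?rpred_nat.
Qed.

(** * Induction on the level *)

Lemma T2_int2 l b n (r : int) : T2 l b.+1 n r \is a int2.
Proof.
elim: b n r => [|b IH] n r; first exact: T2_beta1_int2.
exact: T2_succ_int2.
Qed.

Theorem theorem4p1 (alpha c d e : nat) :
  (d < 2 ^ e)%N ->
  forall l : nat, (l <= d)%N ->
    rat_cong2 (T2 l alpha.+1 (2 ^ alpha * (2 ^ e + d))%N (2 ^ alpha * c)%N%:Z)
              (l == d)%:R.
Proof.
move=> de l ld; apply: rat_cong2P; elim: alpha => [|a IH].
  by rewrite expn0 !mul1n T2_beta1_mod2.
rewrite expnS -!mulnA mul2n PoszM.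
rewrite -[X in X - _](subrK (T2 l a.+1 (2 ^ a * (2 ^ e + d)) (2 ^ a * c)%N%:Z)).
rewrite -addrA mulrDl rpredD //; apply: T2_double_mod2 => m s; exact: T2_int2.
Qed.
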